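(* Let $\ell \ge -1$ be an integer, and let $P$ be an $(n+\ell)$-stable property for which $n(P)$ exists. Let $r\ge 3$ and $n \ge n(P)$ be integers, and suppose $n$ also satisfies $$n \ge \begin{cases} 6\ell+26 & \text{if } r=3\\ \max\left\{3+ \ell + \frac{4(\ell+2)}{r-3},\;5+\ell+\frac{r+2\ell+7}{2r-2}\right\} & \text{if } 4 \le r \le 7\\ \ell+5+\frac{4(\ell+4)}{r-4} & \text{if } r \ge 8.\end{cases}$$ Let $G$ be an $n$-vertex, $K_{r+1}$-free graph that does not have $P$. Then, for all $t \ge 2$, $$k^t(G) \leq k^t(G^{\ell*}_{n,r}).$$ If $G^{\ell*}_{n,r}$ does not have $P$ then the bound is tight.
   Context: Graphs are finite and simple; $d_G(v)$ is the degree of $v$ in $G$. A $t$-clique is a set of $t$ pairwise adjacent vertices; $k^t(G)$ denotes the number of $t$-cliques in $G$. For $s>0$, a property $P$ defined on all $n$-vertex graphs is $s$-stable if whenever $u,v$ are distinct nonadjacent vertices of an $n$-vertex graph $G$ such that $G+uv$ has $P$ and $d_G(u)+d_G(v)\ge s$, then $G$ itself has $P$. Here $(n+\ell)$-stable means $s=n+\ell$, where $n$ is the number of vertices. $n(P)$ denotes an integer such that each complete graph $K_n$ with $n\ge n(P)$ has property $P$, when such a value exists. $T_r(n)$ is the $n$-vertex, $r$-partite Turán graph: the complete $r$-partite graph on $n$ vertices with part sizes differing by at most 1 (if $n<r$ some parts are empty and it is $K_n$). For $-1 \le \ell \le \lceil (r-1)(n-1)/r\rceil-1$, $G^{\ell*}_{n,r}$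 denotes the graph formed from $T_r(n-1)$ by adding a new vertex $x$ such that the (subgraph induced by the) neighborhood of $x$ is isomorphic to $T_{r-1}(\ell+1)$ and disjoint from a smallest part of the $T_r(n-1)$. ''Tight'' means that equality is attained by some $n$-vertex, $K_{r+1}$-free graph not having $P$. *)

(* Defs.v *)
From HB Require Import structures.
From mathcomp Require Import all_boot all_order all_algebra.
From mathcomp Require Import zify lra.

Set Implicit Arguments.
Unset Strict Implicit.
Unset Printing Implicit Defensive.

Import Order.TTheory GRing.Theory Num.Theory.

Section Graphs.
Variable V : finType.

Record sgraph := SGraph {
  edges : {set {set V}};
  edges_card2 : [forall e in edges, #|e| == 2] }.

HB.instance Definition _ := [isSub for edges].
HB.instance Definition _ := [Finite of sgraph by <:].

Lemma card2_filter (E : {set {set V}}) :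
  [forall e in [set e in E | #|e| == 2], #|e| == 2].
Proof. by apply/forall_inP => e; rewrite inE => /andP[]. Qed.

(* Members of E that are not pairs are discarded. *)
Definition graph_of (E : {set {set V}}) : sgraph := SGraph (card2_filter E).

Implicit Types (G : sgraph) (S A : {set V}) (u v x : V).

Definition adj G u v : bool := [set u; v] \in edges G.
Definition nbhd G v : {set V} := [set u | adj G v u].
Definition deg G v : nat := #|nbhd G v|.

Definition complete : sgraph := graph_of [set: {set V}].
Definition add_edge G u v : sgraph := graph_of ([set u; v] |: edges G).

Definition clique G A : bool :=
  [forall u in A, forall v in A, (u != v) ==> adj G u v].
Definition num_cliques (t : nat) G : nat :=
  #|[set A : {set V} | (#|A| == t) && clique G A]|.
Definition clique_free (s : nat) G : Prop :=
  forall A, clique G A -> #|A| <> s.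

Definition stable (s : int) (P : sgraph -> Prop) : Prop :=
  forall G u v, u != v -> ~~ adj G u v ->
    P (add_edge G u v) -> (s <= (deg G u + deg G v)%:Z)%R -> P G.

Definition part r (c : V -> 'I_r) S (i : 'I_r) : {set V} :=
  [set v in S | c v == i].

(* The subgraph of G induced by S is the Turan graph T_r(#|S|), and its parts
   are the (possibly empty) classes [part c S i]. *)
Definition turan_parts G S r (c : V -> 'I_r) : Prop :=
  {in S &, forall u v, adj G u v = (c u != c v)} /\
  (forall i j, #|part c S i| <= #|part c S j|.+1).

(* H is a graph G^{l*}_{n,r}, where n = #|V|. This is a predicate because the
   construction does not determine a graph up to isomorphism: the larger parts
   of the neighborhood of x may lie in larger or in smaller parts of
   T_r(n-1). All the choices give the same numbers of cliques. *)
Definition is_Gstar (l : int) r (H : sgraph) : Prop :=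
  exists (x : V) (c : V -> 'I_r) (i : 'I_r),
  [/\ turan_parts H [set~ x] c,
      forall j, #|part c [set~ x] i| <= #|part c [set~ x] j|,
      [disjoint nbhd H x & part c [set~ x] i],
      (#|nbhd H x|%:Z = l + 1)%R
    & exists c' : V -> 'I_r.-1, turan_parts H (nbhd H x) c'].

End Graphs.

Definition size_threshold (l : int) (r : nat) : rat :=
  (let L : rat := l%:~R in
   let R : rat := r%:R in
   if r == 3%N then 6 * L + 26
   else if (r <= 7)%N then
     Num.max (3 + L + 4 * (L + 2) / (R - 3))
             (5 + L + (R + 2 * L + 7) / (2 * R - 2))
   else L + 5 + 4 * (L + 4) / (R - 4))%R.

Section Existence.

Lemma in_graph_of (V : finType) (E : {set {set V}}) u v :
  adj (graph_of E) u v = ([set u; v] \in E) && (u != v).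
Proof. by rewrite /adj inE cards2; case: (u != v). Qed.

Lemma graph_of_relE (V : finType) (e : rel V) : symmetric e ->
  forall u v, adj (graph_of [set [set p.1; p.2] | p : V * V & e p.1 p.2]) u v
              = (u != v) && e u v.
Proof.
move=> es u v; rewrite in_graph_of andbC; case: (eqVneq u v) => //= uv.
apply/imsetP/idP => [[[a b]] /=|euv]; last by exists (u, v) => //; rewrite inE.
rewrite inE /= => eab /setP E.
have := E u; have := E v; have := E a; have := E b.
rewrite !inE !eqxx !orbT /= => /esym hb /esym ha /esym hv /esym hu.
move: hu hv uv; case/orP=> /eqP->; case/orP=> /eqP->; rewrite ?eqxx // => _.
by rewrite es.
Qed.

Lemma card_mod_class r m j : j < r ->
  #|[set i : 'I_m | i %% r == j]| = (m + (r - j.+1)) %/ r.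
Proof.
move=> jr; rewrite cardsE -sum1_card.
rewrite (eq_bigl (fun i : 'I_m => val i %% r == j)) //.
rewrite -(big_mkord (fun i => i %% r == j) (fun=> 1)) /=.
elim: m => [|m IH]; first by rewrite big_geq // divn_small //; lia.
rewrite big_mkcond big_nat_recr //= -big_mkcond IH addSn divnS; last by lia.
rewrite addnC; congr (_ + _).
have -> : (r %| (m + (r - j.+1)).+1) = (m %% r == j); last by case: eqP.
rewrite -addnS subnSK // -{2}(modn_small jr) -(eqn_modDr (r - j)) subnKC 1?ltnW //.
by rewrite modnn.
Qed.

Lemma mod_class_balanced r m i j : i < r -> j < r ->
  (m + (r - i.+1)) %/ r <= ((m + (r - j.+1)) %/ r).+1.
Proof.
move=> ir jr; have r0 : 0 < r by lia.
have -> : ((m + (r - j.+1)) %/ r).+1 = (m + (r - j.+1) + r) %/ r.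
  have -> : m + (r - j.+1) + r = 1 * r + (m + (r - j.+1)) by lia.
  by rewrite divnMDl // add1n.
by apply: leq_div2r; lia.
Qed.

(* The whole range of l for which G^{l*}_{n,r} is defined. *)
Lemma Gstar_exists (l : int) (r n : nat) : 2 <= r -> 1 <= n ->
  (-1 <= l)%R ->
  (l <= Num.ceil (((r%:R - 1) * (n%:R - 1)) / r%:R : rat) - 1)%R ->
  exists H : sgraph 'I_n, is_Gstar l r H.
Proof.
case: n => // m r2 _ l1 lc.
have [k lk] : exists k : nat, l = (k%:Z - 1)%R by exists `|(l + 1)%R|; lia.
have r0 : 0 < r by lia.
have km : (k%:Z * r%:Z < (r%:Z - 1) * m%:Z + r%:Z)%R.
  have : (l%:~R < ((r%:R - 1) * (m.+1%:R - 1)) / r%:R :> rat)%R.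
    by rewrite -ceil_gt_int; apply: le_lt_trans lc _; rewrite gtrBl.
  rewrite ltr_pdivlMr ?ltr0n // lk => h.
  rewrite -(ltr_int rat) !(rmorphM, rmorphD, rmorphB) /=.
  move: h; rewrite -[m.+1%:R%R]natr1 !rmorphB /= -!pmulrn; lra.
pose x : 'I_m.+1 := ord_max.
pose c (v : 'I_m.+1) : 'I_r := Ordinal (ltn_pmod v r0).
pose phi (z : 'I_k) : nat := z + z %/ r.-1.
have phiE z : phi z = (z %/ r.-1) * r + z %% r.-1.
  rewrite /phi {1}(divn_eq z r.-1); nia.
have r10 : 0 < r.-1 by lia.
have phim z : phi z < m.
  have := phiE z; rewrite /phi => E.
  have := ltn_ord z; have := divn_eq z r.-1; have := ltn_pmod z r10.
  move: (z %/ _) (z %% _) E => q s; nia.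
pose f (z : 'I_k) : 'I_m.+1 := Ordinal (ltnW (phim z) : phi z < m.+1).
pose N : {set 'I_m.+1} := f @: 'I_k.
have finj : injective f.
  move=> z1 z2 /(congr1 val) /= E; apply: val_inj => /=; move: E; rewrite /phi.
  have [le12|/ltnW le21] := leqP z1 z2.
    have := leq_div2r r.-1 le12; move: (_ %/ _) (z2 %/ _) => a b; lia.
  have := leq_div2r r.-1 le21; move: (_ %/ _) (z1 %/ _) => a b; lia.
have fx z : f z != x by rewrite -val_eqE /= ltn_eqF.
have xN : x \notin N by apply/imsetP => -[z _ /eqP]; rewrite eq_sym (negPf (fx z)).
pose e (u v : 'I_m.+1) := [|| [&& u != x, v != x & c u != c v],
  (u == x) && (v \in N) | (v == x) && (u \in N)].
have es : symmetric e.
  move=> u v; rewrite /e (eq_sym (c u)).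
  by case: (u == x); case: (v == x); rewrite //= ?orbF // orbC.
pose H := graph_of [set [set p.1; p.2] | p : 'I_m.+1 * 'I_m.+1 & e p.1 p.2].
have HE u v : adj H u v = (u != v) && e u v := graph_of_relE es u v.
have HN : nbhd H x = N.
  apply/setP => v; rewrite inE HE /e eqxx /= (negPf xN) andbF orbF.
  by case: (eqVneq x v) => // <-; rewrite (negPf xN).
have HE2 u v : u != x -> v != x -> adj H u v = (c u != c v).
  move=> ux vx; rewrite HE /e ux vx (negPf ux) (negPf vx) /= !orbF.
  by case: (eqVneq u v) => // ->; rewrite eqxx.
have cardp (j : 'I_r) : #|part c [set~ x] j| = (m + (r - j.+1)) %/ r.
  rewrite -card_mod_class //.
  have winj : injective (widen_ord (leqnSn m)).
    by move=> a b /(congr1 val) /= E; apply: val_inj.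
  rewrite -(card_imset _ winj); apply: eq_card => v.
  rewrite !inE -val_eqE /=; apply/andP/imsetP.
    move=> [vx vj]; have vm : v < m by rewrite ltn_neqAle vx -ltnS ltn_ord.
    by exists (Ordinal vm); [rewrite inE | apply: val_inj].
  by move=> [w + ->]; rewrite inE /= => wj; split=> //; rewrite ltn_eqF.
have rm1 : r.-1 < r by lia.
exists H, x, c, (Ordinal rm1); split.
- split; first by move=> u v; rewrite !inE => ux vx; exact: HE2.
  by move=> i j; rewrite !cardp mod_class_balanced.
- by move=> j; rewrite !cardp /=; apply: leq_div2r; have := ltn_ord j; lia.
- rewrite HN; apply/pred0P => v /=; apply/andP => -[/imsetP[z _ ->]].
  rewrite inE => /andP[_ /eqP/(congr1 val)] /=.
  rewrite phiE modnMDl modn_small; have := ltn_pmod z r10; lia.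
- by rewrite HN card_imset // card_ord lk; lia.
have c'P (v : 'I_m.+1) : (v %% r) %% r.-1 < r.-1 by rewrite ltn_pmod.
pose c' (v : 'I_m.+1) : 'I_r.-1 := Ordinal (c'P v).
have fmod z : f z %% r = z %% r.-1.
  by rewrite /= phiE modnMDl modn_small //; have := ltn_pmod z r10; lia.
exists c'; rewrite HN; split.
  move=> _ _ /imsetP[z _ ->] /imsetP[w _ ->]; rewrite HE2 //.
  by rewrite -!val_eqE [val _]fmod [val (c _)]fmod /= !fmod !modn_mod.
have cardp' (j : 'I_r.-1) : #|part c' N j| = (k + (r.-1 - j.+1)) %/ r.-1.
  rewrite -card_mod_class // -(card_imset _ finj); apply: eq_card => v.
  rewrite inE; apply/andP/imsetP => [[/imsetP[z _ ->]]|[z + ->]].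
    by rewrite -val_eqE /= fmod modn_mod => zj; exists z; rewrite ?inE.
  by rewrite inE -val_eqE /= fmod modn_mod imset_f.
by move=> i j; rewrite !cardp' mod_class_balanced.
Qed.

(* In the range of n considered, graphs G^{l*}_{n,r} exist. *)
Lemma Gstar_exists_size_threshold (l : int) (r n : nat) : 3 <= r ->
  (-1 <= l)%R -> (size_threshold l r <= n%:R)%R ->
  exists H : sgraph 'I_n, is_Gstar l r H.
Proof.
move=> r3 l1 hn.
have L1 : (-1 <= l%:~R :> rat)%R by rewrite -(ler_int rat) in l1.
have R3 : (3 <= r%:R :> rat)%R by rewrite ler_nat.
have key : (1 <= (n%:R : rat))%R /\
    (l%:~R * r%:R < (r%:R - 1) * (n%:R - 1) :> rat)%R.
  move: hn; rewrite /size_threshold; case: eqP => [->|/eqP rn3] /=.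
    by move=> hn; split; lra.
  have R4 : (4 <= r%:R :> rat)%R by rewrite ler_nat ltn_neqAle eq_sym rn3.
  have R8 : (7 < r)%N -> (8 <= r%:R :> rat)%R by rewrite ler_nat.
  rewrite leqNgt; case: (ltnP 7 r) R8 => /= _.
    move=> /(_ isT); move: L1.
    move: (l%:~R%R : rat) (r%:R%R : rat) (n%:R%R : rat).
    move=> L R N L1 R8; set q := (4 * (L + 4) / (R - 4))%R => hn.
    have qE : (q * (R - 4) = 4 * (L + 4))%R by rewrite /q divfK //; apply: lt0r_neq0; lra.
    have q0 : (0 <= q)%R by apply: divr_ge0; lra.
    by split; nra.
  move=> _; move: L1 R4.
  move: (l%:~R%R : rat) (r%:R%R : rat) (n%:R%R : rat).
  move=> L R N L1 R4; rewrite ge_max => /andP[+ _].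
  set q := (4 * (L + 2) / (R - 3))%R => hn.
  have qE : (q * (R - 3) = 4 * (L + 2))%R by rewrite /q divfK //; apply: lt0r_neq0; lra.
  have q0 : (0 <= q)%R by apply: divr_ge0; lra.
  by split; nra.
have [n1 lr] := key.
apply: Gstar_exists => //; [by lia | by move: n1; rewrite ler1n |].
by rewrite lerBrDr lezD1 ceil_gt_int ltr_pdivlMr // ltr0n; lia.
Qed.

End Existence.

(* Main.v *)
Require Import Defs.
From mathcomp Require Import all_boot all_order all_algebra.
From mathcomp Require Import zify lra.

Set Implicit Arguments.
Unset Strict Implicit.
Unset Printing Implicit Defensive.

Import Order.TTheory GRing.Theory Num.Theory.

(* Write k = l + 1. Closing G under the addition of edges whose ends have degree
   sum at least n + l yields a graph without P, hence not complete. A nonadjacent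
   pair of maximal degree sum in it shows that either G has a vertex of degree at
   most k, or for some s >= 2 with 2s + k <= n there are s vertices of degree at
   most h = s + k - 1.

   In the first case delete that vertex and apply Zykov's theorem to the rest and
   to its neighborhood. In the second case, deleting the s vertices gives
     k^t(G) <= k^t(T_r(n-s)) + s k^{t-1}(T_{r-1}(h)).
   As a |-> k^{t-1}(T_{r-1}(a)) is convex, a supporting line at h reduces the
   comparison with G* to t = 2, where the bound is convex in s and is attained at
   s = 1. For r >= 4 this suffices.

   For r = 3 and s >= 3 the edges are instead counted from degree sums: by Erdos, the
   degrees of G are majorized by those of a complete 3-partite graph. Triangles are
   then controlled by the Fisher-Ryan inequality k^3(G)^2 <= (k^2(G)/3)^3 for
   K_4-free graphs, with (e/3)^(3/2) replaced by a quadratic in e that agrees with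
   it at e = (n-1)^2/3. *)

(** * Counting cliques inside vertex subsets *)

Section Cliques.
Variables (V : finType) (G : sgraph V).
Implicit Types (S T A B : {set V}) (u v w : V).

Definition cliques_within t S : {set {set V}} :=
  [set A : {set V} | [&& A \subset S, #|A| == t & clique G A]].
Definition ncliques t S := #|cliques_within t S|.

Lemma adjxx v : adj G v v = false.
Proof.
apply/negP => /(forall_inP (edges_card2 G)); rewrite setUid cards1.
by [].
Qed.

Lemma adjC u v : adj G u v = adj G v u.
Proof. by rewrite /adj setUC. Qed.

Lemma num_cliquesE t : num_cliques t G = ncliques t setT.
Proof. by apply: eq_card => A; rewrite !inE subsetT. Qed.

Lemma cliqueU1 v B : v \notin B ->
  clique G (v |: B) = (B \subset nbhd G v) && clique G B.
Proof.
move=> vB; apply/idP/andP => [/forall_inP cl|[sB cl]].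
  split.
    apply/subsetP => b bB; rewrite inE.
    have /forall_inP/(_ b) := cl v (setU11 _ _).
    rewrite !inE bB orbT => /(_ isT) /implyP; apply.
    by apply: contraNneq vB => ->.
  apply/forall_inP => u uB; apply/forall_inP => w wB.
  by have /forall_inP := cl u (setU1r _ uB); apply; rewrite setU1r.
apply/forall_inP => u /setU1P[->|uB]; apply/forall_inP => w /setU1P[->|wB];
  apply/implyP => uw.
- by rewrite eqxx in uw.
- by have := subsetP sB w wB; rewrite inE.
- by have := subsetP sB u uB; rewrite inE adjC.
- by move: cl => /forall_inP/(_ u uB)/forall_inP/(_ w wB)/implyP; apply.
Qed.

(** A clique either avoids v or is v joined to a clique of its neighborhood. Almost every induction
    below deletes a vertex by this recurrence. *)
Lemma ncliques_del t S v : v \in S ->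
  ncliques t.+1 S = ncliques t.+1 (S :\ v) + ncliques t (S :&: nbhd G v).
Proof.
move=> vS; rewrite /ncliques -(cardsID [set A : {set V} | v \in A]) addnC.
congr (_ + _).
  apply: eq_card => A; rewrite !inE subsetD1.
  by case: (v \in A); rewrite ?andbF // andbT.
rewrite -[RHS](card_in_imset (f := fun B => v |: B)); last first.
  have vN B : B \in cliques_within t (S :&: nbhd G v) -> v \notin B.
    rewrite inE => /and3P[/subsetP sB _ _]; apply/negP => /sB.
    by rewrite !inE adjxx andbF.
  move=> B1 B2 /vN v1 /vN v2 E.
  by rewrite -(setU1K v1) -(setU1K v2) E.
apply: eq_card => A; rewrite !inE; apply/andP/imsetP.
  case=> /and3P[sA /eqP cA cl] vA; exists (A :\ v); last by rewrite setD1K.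
  have vB : v \notin A :\ v by rewrite !inE eqxx.
  move: cl cA; rewrite -{1 2}(setD1K vA) cliqueU1 // cardsU1 vB add1n => /andP[sB cB] [cA].
  rewrite inE cB subsetI sB cA eqxx !andbT.
  by apply: subset_trans sA; apply: subsetDl.
case=> B; rewrite inE subsetI => /and3P[/andP[sB nB] /eqP cB cl] ->.
have vB : v \notin B by apply/negP => /(subsetP nB); rewrite inE adjxx.
by rewrite setU11 cliqueU1 // cardsU1 vB cB nB cl subUset sub1set vS sB eqxx.
Qed.

Lemma ncliques_sub t S T : S \subset T -> ncliques t S <= ncliques t T.
Proof.
move=> ST; apply/subset_leq_card/subsetP => A; rewrite !inE.
by case/and3P => sA -> ->; rewrite (subset_trans sA ST).
Qed.

Lemma card_rem n S v : v \in S -> #|S| = n.+1 -> #|S :\ v| = n.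
Proof. by move=> vS; rewrite (cardsD1 v S) vS => -[]. Qed.

Lemma ncliques0 S : ncliques 0 S = 1.
Proof.
apply/eqP/cards1P; exists set0; apply/setP => A; rewrite !inE cards_eq0.
case: eqP => [->|_]; last by rewrite andbF.
by rewrite sub0set; apply/forall_inP => u; rewrite inE.
Qed.

Lemma ncliquesS0 t : ncliques t.+1 set0 = 0.
Proof.
apply/eqP; rewrite cards_eq0; apply/eqP/setP => A; rewrite !inE subset0.
by case: eqP => // ->; rewrite cards0.
Qed.

Lemma ncliques1 S : ncliques 1 S = #|S|.
Proof.
move: {2}#|S| (erefl #|S|) => n; elim: n S => [|n IH] S cS.
  by rewrite cS (cards0_eq cS) ncliquesS0.
have [v vS] : exists v, v \in S by apply/set0Pn; rewrite -cards_eq0 cS.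
by rewrite (ncliques_del _ vS) ncliques0 IH (card_rem vS cS) ?cS ?addn1.
Qed.

Lemma ncliques_vanish s t S : s <= t -> ncliques s S = 0 -> ncliques t S = 0.
Proof.
elim: s t S => [|s IH] [|t] S st; rewrite ?ncliques0 //.
move: {2}#|S| (erefl #|S|) => n; elim: n S => [|n IHn] S cS.
  by rewrite (cards0_eq cS) !ncliquesS0.
have [v vS] : exists v, v \in S by apply/set0Pn; rewrite -cards_eq0 cS.
rewrite !(ncliques_del _ vS) => /eqP; rewrite addn_eq0 => /andP[/eqP a /eqP b].
by rewrite (IHn _ (card_rem vS cS) a) (IH t).
Qed.

Lemma clique_free_ncliques s : clique_free s G -> ncliques s setT = 0.
Proof.
move=> cf; apply/eqP; rewrite cards_eq0; apply/eqP/setP => A; rewrite !inE.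
by apply/negbTE/negP => /and3P[_ /eqP cA /cf].
Qed.

(* [g] bounds the number of nonneighbors, each vertex being one of its own; the
   clique is grown greedily. *)
Lemma clique_exists g j S :
  (forall v, v \in S -> #|S :\: nbhd G v| <= g) -> j * g < #|S| ->
  0 < ncliques j.+1 S.
Proof.
elim: j S => [|j IH] S hg hS; first by rewrite ncliques1.
have [v vS] : exists v, v \in S by apply/set0Pn; rewrite -card_gt0; lia.
rewrite (ncliques_del _ vS) addn_gt0; apply/orP; right; apply: IH.
  move=> w /setIP[wS _]; apply: leq_trans (hg w wS).
  by apply/subset_leq_card/setSD/subsetIl.
by have := hg v vS; have := cardsID (nbhd G v) S; lia.
Qed.

(** Otherwise every vertex has at most g nonneighbors, itself included, and r g <= #|S| - 1 lets
    [clique_exists] produce an (r+1)-clique. The bound is exactly the neighborhood size in the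
    recursion of [turan_cliques]. *)
Lemma low_degree_vertex r S : ncliques r.+1 S = 0 -> 0 < #|S| ->
  exists2 v, v \in S & #|S :&: nbhd G v| <= #|S|.-1 - #|S|.-1 %/ r.
Proof.
move=> hS S0; set g := _ %/ r.
have [/existsP[v /andP[vS hv]]|] :=
  boolP [exists v, (v \in S) && (g < #|S :\: nbhd G v|)].
  by exists v => //; have := cardsID (nbhd G v) S; lia.
rewrite negb_exists => /forallP hn.
have := @clique_exists g r S; rewrite hS => /(_ _ _)/implyP; case=> //.
  by move=> v vS; have := hn v; rewrite vS /= -leqNgt.
by have := leq_trunc_div #|S|.-1 r; rewrite -/g; lia.
Qed.

End Cliques.

(** * Clique counts of Turan graphs *)

(* [turan_cliques t r n] is the number of t-cliques of T_r(n): the (i+1)-st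
   vertex, added to a smallest part of T_r(i), has a copy of
   T_{r-1}(i - floor(i/r)) as its neighborhood. *)
Fixpoint turan_cliques t r n :=
  match t, r with
  | 0, _ => 1
  | _.+1, 0 => 0
  | t.+1, r.+1 => \sum_(i < n) turan_cliques t r (i - i %/ r.+1)
  end.

Definition turan_edges r n := \sum_(i < n) (i - i %/ r).

Lemma leq_subdiv r m n : m <= n -> m - m %/ r <= n - n %/ r.
Proof.
case: r => [|r]; first by rewrite !divn0 !subn0.
elim: n => [|n IH]; first by rewrite leqn0 => /eqP->.
rewrite leq_eqVlt => /predU1P[-> //|/IH]; move=> h; apply: (leq_trans h).
by rewrite divnS //; case: (_ %| _) => /=; lia.
Qed.

Lemma turan_cliquesS t r n :
  turan_cliques t.+1 r.+1 n.+1 =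
  turan_cliques t.+1 r.+1 n + turan_cliques t r (n - n %/ r.+1).
Proof. by rewrite /= big_ord_recr. Qed.

Lemma turan_cliques_mono t r m n :
  m <= n -> turan_cliques t r m <= turan_cliques t r n.
Proof.
case: t => [|t] //; case: r => [|r] // mn.
elim: n mn => [|n IH]; first by rewrite leqn0 => /eqP->.
rewrite leq_eqVlt => /predU1P[-> //|/IH]; move=> h; apply: (leq_trans h).
by rewrite turan_cliquesS leq_addr.
Qed.

Lemma turan_cliques1 r n : turan_cliques 1 r.+1 n = n.
Proof. by rewrite /= sum_nat_const card_ord muln1. Qed.

Lemma turan_cliques2 r n : turan_cliques 2 r.+2 n = turan_edges r.+2 n.
Proof. by apply: eq_bigr => i _; apply: turan_cliques1. Qed.

(* Supporting line at h of the convex function a |-> turan_cliques t.+1 r.+1 a. *)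
Lemma turan_cliques_tangent t r h a :
  turan_cliques t.+1 r.+1 h + turan_cliques t r (h - h %/ r.+1) * a <=
  turan_cliques t.+1 r.+1 a + turan_cliques t r (h - h %/ r.+1) * h.
Proof.
set w := turan_cliques t r _; have [ha|/ltnW ah] := leqP h a.
  rewrite -(subnKC ha); elim: (a - h) => [|d IH]; first by rewrite addn0.
  have : w <= turan_cliques t r (h + d - (h + d) %/ r.+1).
    by apply/turan_cliques_mono/leq_subdiv/leq_addr.
  by rewrite addnS turan_cliquesS mulnS; move: IH; lia.
suff H d : a + d <= h ->
    turan_cliques t.+1 r.+1 (a + d) + w * a <= turan_cliques t.+1 r.+1 a + w * (a + d).
  by have := H (h - a); rewrite subnKC //; apply.
elim: d => [|d IH] dh; first by rewrite addn0.
have : turan_cliques t r (a + d - (a + d) %/ r.+1) <= w.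
  by apply/turan_cliques_mono/leq_subdiv; lia.
have := IH ltac:(lia); rewrite addnS turan_cliquesS mulnS; lia.
Qed.

(** * Zykov's theorem, and the matching lower bound for Turan graphs *)

Section Turan.
Variables (V : finType) (G : sgraph V).
Implicit Types (S T A B : {set V}) (u v w : V).

(** Deleting a vertex from [low_degree_vertex] follows the recursion of [turan_cliques]: the
    remainder is still K_{r+1}-free and the neighborhood is K_r-free. *)
Lemma zykov t r S : ncliques G r.+1 S = 0 -> ncliques G t S <= turan_cliques t r #|S|.
Proof.
elim: t r S => [|t IHt] r S hS; first by rewrite ncliques0.
move: {2}#|S| (erefl #|S|) => n; elim: n S hS => [|n IHn] S hS cS.
  by rewrite (cards0_eq cS) ncliquesS0.
case: r => [|r] in hS IHn *.
  by move: hS; rewrite ncliques1 cS.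
have [|v vS dv] := low_degree_vertex hS; first by rewrite cS.
move: hS; rewrite (ncliques_del _ _ vS) => /eqP; rewrite addn_eq0 => /andP[/eqP h1 /eqP h2].
have cS' := card_rem vS cS.
rewrite (ncliques_del _ _ vS) cS turan_cliquesS -{1}cS' leq_add ?IHn //.
apply: leq_trans (IHt _ _ h2) _; apply: turan_cliques_mono.
by move: dv; rewrite cS.
Qed.

(** A vertex of a largest part is deleted: the rest stays balanced, and the neighborhood loses
    exactly that part. The set C of available colors lets the induction drop a color while the color
    type stays fixed. *)
Lemma turan_lower t r q (c : V -> 'I_q) (C : {set 'I_q}) S : #|C| = r ->
  {in S, forall v, c v \in C} ->
  {in S &, forall u v, adj G u v = (c u != c v)} ->
  {in C &, forall i j, #|part c S i| <= #|part c S j|.+1} ->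
  turan_cliques t r #|S| <= ncliques G t S.
Proof.
elim: t r C S => [|t IHt] r C S cC SC Sadj bal; first by rewrite ncliques0.
move: {2}#|S| (erefl #|S|) => n; elim: n S SC Sadj bal => [|n IHn] S SC Sadj bal cS.
  by rewrite cS; case: (r) => //= r'; rewrite big_ord0.
have [v0 v0S] : exists v, v \in S by apply/set0Pn; rewrite -cards_eq0 cS.
case: r => [|r] in cC IHn *; first by have := SC _ v0S; rewrite (cards0_eq cC) inE.
case: (@arg_maxnP _ (c v0) (mem C) (fun i => #|part c S i|) (SC _ v0S)) => j jC jmax.
have [v vj] : exists v, v \in part c S j.
  apply/set0Pn; rewrite -card_gt0.
  apply: leq_trans (jmax _ (SC _ v0S)); rewrite card_gt0; apply/set0Pn.
  by exists v0; rewrite inE v0S eqxx.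
have /andP[vS /eqP cv] : (v \in S) && (c v == j) by move: vj; rewrite inE.
have cSsum : #|S| = \sum_(i in C) #|part c S i|.
  rewrite -sum1_card (partition_big c (mem C)) //=; apply: eq_bigr => i _.
  by rewrite -sum1_card; apply: eq_bigl => u; rewrite inE.
have NE : S :&: nbhd G v = S :\: part c S j.
  apply/setP => u; rewrite !inE; case uS : (u \in S); rewrite /= ?andbF // andbT.
  by rewrite Sadj // cv eq_sym.
have partN i : i != j -> part c (S :&: nbhd G v) i = part c S i.
  move=> ij; apply/setP => u; rewrite NE !inE.
  case: (eqVneq (c u) i) => [->|_]; last by rewrite !andbF.
  by rewrite (negPf ij) andbF.
have partD i : i != j -> part c (S :\ v) i = part c S i.
  move=> ij; apply/setP => u; rewrite !inE.
  case: (eqVneq u v) => //= ->.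
  by rewrite cv eq_sym (negPf ij) andbF.
have partDj : #|part c S j| = #|part c (S :\ v) j|.+1.
  rewrite (cardsD1 v) vj; congr (_.+1); apply: eq_card => u; rewrite !inE.
  by rewrite andbA.
have cS' := card_rem vS cS.
rewrite (ncliques_del _ _ vS) cS turan_cliquesS -{1}cS'; apply: leq_add.
  apply: IHn => //.
  - by move=> u /setD1P[_]; apply: SC.
  - by move=> u w /setD1P[_ uS] /setD1P[_ wS]; apply: Sadj.
  - move=> i1 i2 i1C i2C.
    have := jmax _ i1C; have := jmax _ i2C; have := bal _ _ i1C i2C.
    have := bal _ _ jC i2C; rewrite /=.
    case: (eqVneq i1 j) => [->|h1]; case: (eqVneq i2 j) => [->|h2];
      rewrite ?(partD _ h1) ?(partD _ h2); lia.
have cardN : #|S :&: nbhd G v| = #|S| - #|part c S j|.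
  by rewrite NE cardsD (setIidPr _) //; apply/subsetP => u; rewrite inE => /andP[].
apply: leq_trans (IHt r (C :\ j) _ _ _ _ _).
- apply: turan_cliques_mono; rewrite cardN.
  (* By balance every other part has at least [#|part c S j|.-1] vertices, so the largest part has
     at most n / (r+1) + 1, rounded down. *)
  have : r.+1 * #|part c S j|.-1 <= n.
    rewrite -ltnS -cS cSsum (bigD1 j) //= mulSn.
    have h : r * #|part c S j|.-1 <= \sum_(i in C | i != j) #|part c S i|.
      have <- : #|C :\ j| = r by exact: card_rem jC cC.
      rewrite -sum_nat_const; rewrite (eq_bigl (fun i => (i \in C) && (i != j))).
        apply: leq_sum => i /andP[iC _].
        by have := bal _ _ jC iC; lia.
      by move=> i; rewrite !inE andbC.
    by apply: leq_trans (leq_add (leqnn _) h); rewrite ltn_add2r partDj.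
  rewrite mulnC -leq_divRL //; lia.
- exact: card_rem jC cC.
- move=> u; rewrite NE !inE => /andP[+ uS]; rewrite uS /= => ->.
  by rewrite SC.
- by move=> u w /setIP[uS _] /setIP[wS _]; apply: Sadj.
- move=> i1 i2 /setD1P[h1 i1C] /setD1P[h2 i2C].
  by rewrite !partN //; apply: bal.
Qed.

End Turan.

(** * The number of edges of a Turan graph *)

Lemma turan_edgesS r n : turan_edges r n.+1 = turan_edges r n + (n - n %/ r).
Proof. exact: big_ord_recr. Qed.

Lemma turan_edges_closed r n : 0 < r ->
  2 * r * turan_edges r n + (n %% r) * (r - n %% r) = r.-1 * n ^ 2.
Proof.
move=> r0; elim: n => [|n IH]; first by rewrite /turan_edges big_ord0 mod0n !muln0.
rewrite turan_edgesS.
have E := divn_eq n r; have lt := ltn_pmod n r0.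
have Em : n.+1 %% r = (n %% r).+1 %% r by rewrite -addn1 -modnDml addn1.
move: IH E lt; rewrite {}Em.
move: (n %/ r) (n %% r) (turan_edges r n) => q p a IH nE pr.
have [d rE] : exists d, r = (p + d).+1 by exists (r - p.+1); lia.
have nq : n - q = q * (p + d) + p by rewrite nE rE mulnS; lia.
rewrite {}nq; move: IH; rewrite {}nE {}rE {r0 pr} /=.
have -> : (p + d).+1 - p = d.+1 by lia.
(* For d = 0 the residue of n is r - 1 and that of n + 1 wraps around to 0. *)
case: d => [|d]; first by rewrite addn0 modnn /= !expnS !expn0; lia.
rewrite modn_small ?expnS ?expn0; last by lia.
have -> : (p + d.+1).+1 - p.+1 = d.+1 by lia.
lia.
Qed.

(** * Degree majorization and the Fisher-Ryan inequality *)

Section Bounds.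
Variables (V : finType) (G : sgraph V).
Implicit Types (S A B X : {set V}) (u v w : V).

Lemma sum_adj S v : \sum_(u in S :\ v) (adj G v u : nat) = #|S :&: nbhd G v|.
Proof.
rewrite -sum1_card [RHS](eq_bigl (fun u => (u \in S :\ v) && adj G v u)).
  by rewrite big_mkcondr; apply: eq_bigr => u _; case: (adj G v u).
move=> u; rewrite !inE; case: (eqVneq u v) => //= ->.
by rewrite adjxx andbF.
Qed.

Lemma handshake S : \sum_(v in S) #|S :&: nbhd G v| = 2 * ncliques G 2 S.
Proof.
move: {2}#|S| (erefl #|S|) => n; elim: n S => [|n IH] S cS.
  by rewrite (cards0_eq cS) big_set0 ncliquesS0.
have [v vS] : exists v, v \in S by apply/set0Pn; rewrite -cards_eq0 cS.
rewrite (ncliques_del _ _ vS) ncliques1 mulnDr -(IH _ (card_rem vS cS)) (big_setD1 v) //=.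
have -> : \sum_(u in S :\ v) #|S :&: nbhd G u| =
    \sum_(u in S :\ v) (#|(S :\ v) :&: nbhd G u| + adj G v u).
  apply: eq_bigr => u uS; rewrite (cardsD1 v) !inE vS adjC addnC.
  by congr (_ + _); apply: eq_card => w; rewrite !inE andbA.
by rewrite big_split /= sum_adj; lia.
Qed.

(* Erdos: split off the nonneighbors of a vertex of maximal degree as one class. *)
Lemma degree_majorization r S : ncliques G r.+1 S = 0 ->
  exists2 c : V -> nat, {in S, forall v, c v < r} &
    {in S, forall v, #|S :&: nbhd G v| + #|[set u in S | c u == c v]| <= #|S|}.
Proof.
elim: r S => [|r IH] S hS.
  move: hS; rewrite ncliques1 => /cards0_eq->.
  by exists (fun=> 0) => v; rewrite inE.
have [-> | [v0 v0S]] := set_0Vmem S.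
  by exists (fun=> 0) => v; rewrite inE.
case: (@arg_maxnP _ v0 (mem S) (fun v => #|S :&: nbhd G v|) v0S) => v vS vmax.
move: hS; rewrite (ncliques_del _ _ vS) => /eqP; rewrite addn_eq0 => /andP[_ /eqP].
set N := S :&: nbhd G v => /IH[c cr cN].
have NS : N \subset S := subsetIl _ _.
have WE u : u \in S -> u \notin N ->
    [set w in S | (if w \in N then c w else r) == r] = S :\: N.
  move=> uS uN; apply/setP => w; rewrite in_setD in_set; case wN: (w \in N).
    by have := cr _ wN; case: eqP => [->|_]; rewrite ?ltnn //= andbF.
  by rewrite eqxx andbT.
exists (fun u => if u \in N then c u else r) => u uS.
  by case: ifP => // /cr; lia.
case: ifPn => uN.
  have -> : [set w in S | (if w \in N then c w else r) == c u] =
            [set w in N | c w == c u].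
    apply/setP => w; rewrite 2!in_set; case: ifP => wN.
      by rewrite (subsetP NS).
    by have := cr _ uN; case: eqP => [->|_]; rewrite ?ltnn //= andbF.
  have := cN u uN.
  have : #|S :&: nbhd G u| <= #|N :&: nbhd G u| + #|S :\: N|.
    rewrite -(cardsID N (S :&: nbhd G u)); apply: leq_add.
      by apply/subset_leq_card/subsetP => w; rewrite !inE => /andP[/andP[_ ->] ->].
    by apply/subset_leq_card/setSD/subsetIl.
  have := cardsID N S; rewrite (setIidPr NS); lia.
rewrite (WE u) //; have := cardsID N S; rewrite (setIidPr NS).
by have := vmax _ uS; rewrite -/N /=; lia.
Qed.

(* AM-GM: t <= sqrt (T d^2 / 4) <= d (T + c^2) / (4 c) with c = M / 3. *)
Lemma triangle_weight (T d t M : nat) :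
  t <= T -> 4 * t <= d ^ 2 -> 12 * M * t <= d * (9 * T + M ^ 2).
Proof.
move=> tT td; rewrite -leq_sqr.
have h1 : 4 * t ^ 2 <= d ^ 2 * T.
  by rewrite expnS expn1 mulnA; apply: leq_mul.
have h2 : 36 * M ^ 2 * T <= (9 * T + M ^ 2) ^ 2.
  have := (nat_AGM2 (9 * T) (M ^ 2)).1; lia.
rewrite [X in _ <= X]expnMn; apply: leq_trans (leq_mul (leqnn _) h2).
have := leq_mul (leqnn (36 * M ^ 2)) h1; rewrite !expnMn.
by move: (M ^ 2) (t ^ 2) (d ^ 2) => a b c; lia.
Qed.

(** The vertices outside X are deleted one at a time; [triangle_weight] bounds the ratio of
    triangles to edges lost at each deletion. *)
Lemma triangle_edge_slope (T M : nat) X S : X \subset S -> ncliques G 4 S = 0 ->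
  {in S, forall w, ncliques G 2 (S :&: nbhd G w) <= T} ->
  12 * M * ncliques G 3 S + (9 * T + M ^ 2) * ncliques G 2 X <=
  (9 * T + M ^ 2) * ncliques G 2 S + 12 * M * ncliques G 3 X.
Proof.
move: {2}#|S :\: X| (erefl #|S :\: X|) => n.
elim: n S => [|n IH] S cS XS h4 hT.
  have SX : S \subset X by rewrite -setD_eq0; apply/eqP/cards0_eq.
  have -> : S = X by apply/eqP; rewrite eqEsubset SX XS.
  by rewrite addnC.
have [v] : exists v, v \in S :\: X by apply/set0Pn; rewrite -cards_eq0 cS.
move=> vSX; have /setDP[vS vX] := vSX.
have c' : #|(S :\ v) :\: X| = n.
  by rewrite -(card_rem vSX cS); apply: eq_card => u; rewrite !inE andbCA.
have X' : X \subset S :\ v by rewrite subsetD1 XS.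
move: h4; rewrite (ncliques_del _ _ vS) => /eqP; rewrite addn_eq0 => /andP[/eqP h41 /eqP h42].
(* Mantel's bound in the triangle-free neighborhood of v. *)
have hN : 4 * ncliques G 2 (S :&: nbhd G v) <= #|S :&: nbhd G v| ^ 2.
  have := zykov 2 h42; rewrite turan_cliques2.
  have := @turan_edges_closed 2 #|S :&: nbhd G v| isT; rewrite /= mul1n.
  by move: (_ * (2 - _)); lia.
have := triangle_weight M (hT _ vS) hN.
have : 12 * M * ncliques G 3 (S :\ v) + (9 * T + M ^ 2) * ncliques G 2 X <=
  (9 * T + M ^ 2) * ncliques G 2 (S :\ v) + 12 * M * ncliques G 3 X.
  apply: IH => // w /setD1P[_ wS]; apply: leq_trans (hT w wS).
  by apply/ncliques_sub/setSI/subsetDl.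
by rewrite !(ncliques_del _ _ vS) ncliques1 !mulnDr; lia.
Qed.

(* Each vertex outside the neighborhood X of a vertex with a maximal number T of
   triangles adds, when deleted with d neighbors left, at most min (T, d^2/4)
   triangles and d edges; X spans T edges and no triangle. The parameter M
   linearizes (k^2/3)^(3/2), with equality at 9 k^2 = 3 M^2. *)
Lemma fisher_ryan S M : ncliques G 4 S = 0 ->
  432 * M * ncliques G 3 S <= (9 * ncliques G 2 S + M ^ 2) ^ 2.
Proof.
move=> h4; have [->|[v0 v0S]] := set_0Vmem S; first by rewrite ncliquesS0 muln0.
case: (@arg_maxnP _ v0 (mem S) (fun v => ncliques G 2 (S :&: nbhd G v)) v0S) => v vS vmax.
have hX : ncliques G 3 (S :&: nbhd G v) = 0.
  by move: h4; rewrite (ncliques_del _ _ vS) => /eqP; rewrite addn_eq0 => /andP[_ /eqP].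
have := triangle_edge_slope M (subsetIl S (nbhd G v)) h4 vmax; rewrite hX muln0 addn0.
set T := ncliques G 2 (S :&: nbhd G v); set e := ncliques G 2 S; set k := ncliques G 3 S => h.
have Te : T <= e by apply/ncliques_sub/subsetIl.
have h' : 12 * M * k <= (9 * T + M ^ 2) * (e - T) by rewrite mulnBr; lia.
have -> : 432 * M * k = 36 * (12 * M * k) by lia.
apply: leq_trans (leq_mul (leqnn _) h') _.
have := (nat_AGM2 (9 * T + M ^ 2) (9 * (e - T))).1.
have -> : 9 * T + M ^ 2 + 9 * (e - T) = 9 * e + M ^ 2 by lia.
lia.
Qed.

End Bounds.

(** * Triangles of T_3(n), by residue of n modulo 3 *)

Lemma turan_triangles q : turan_cliques 3 3 (3 * q) = q ^ 3.
Proof.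
elim: q => [|q IH]; first by rewrite muln0 /= big_ord0.
have -> : 3 * q.+1 = (3 * q).+3 by lia.
rewrite !turan_cliquesS IH !turan_cliques2.
have -> : (3 * q) %/ 3 = q by lia.
have -> : (3 * q).+1 %/ 3 = q by lia.
have -> : (3 * q).+2 %/ 3 = q by lia.
have := @turan_edges_closed 2 (3 * q - q) isT.
have := @turan_edges_closed 2 ((3 * q).+1 - q) isT.
have := @turan_edges_closed 2 ((3 * q).+2 - q) isT.
have -> : 3 * q - q = 2 * q by lia.
have -> : (3 * q).+1 - q = 2 * q + 1 by lia.
have -> : (3 * q).+2 - q = 2 * q + 2 by lia.
have -> : (2 * q) %% 2 = 0 by lia.
have -> : (2 * q + 1) %% 2 = 1 by lia.
have -> : (2 * q + 2) %% 2 = 0 by lia.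
rewrite /= !expnS !expn0; lia.
Qed.

Lemma turan_triangles1 q : turan_cliques 3 3 (3 * q).+1 = q ^ 3 + q ^ 2.
Proof.
rewrite turan_cliquesS turan_triangles turan_cliques2.
have -> : (3 * q) %/ 3 = q by lia.
have -> : 3 * q - q = 2 * q by lia.
have := @turan_edges_closed 2 (2 * q) isT.
have -> : (2 * q) %% 2 = 0 by lia.
rewrite /= !expnS !expn0; lia.
Qed.

Lemma turan_triangles2 q : turan_cliques 3 3 (3 * q).+2 = q ^ 3 + 2 * q ^ 2 + q.
Proof.
rewrite turan_cliquesS turan_triangles1 turan_cliques2.
have -> : (3 * q).+1 %/ 3 = q by lia.
have -> : (3 * q).+1 - q = 2 * q + 1 by lia.
have := @turan_edges_closed 2 (2 * q + 1) isT.
have -> : (2 * q + 1) %% 2 = 1 by lia.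
rewrite /= !expnS !expn0; lia.
Qed.

(** * Reduction to edge counts, and the edge comparison for r >= 4 *)

(** The d vertices that extend the Turan graph on m vertices, and a further vertex with k neighbors,
    are each compared with h through the supporting line of slope w. In the sum the linear terms
    amount to w times the slack of the edge hypothesis. *)
Lemma turan_cliques_gap t r m d h k :
  turan_edges r.+2 m + d.+1 * h <= turan_edges r.+2 (m + d) + k ->
  turan_cliques t.+2 r.+2 m + d.+1 * turan_cliques t.+1 r.+1 h <=
  turan_cliques t.+2 r.+2 (m + d) + turan_cliques t.+1 r.+1 k.
Proof.
set w := turan_cliques t r (h - h %/ r.+1) => hE.
have H : turan_cliques t.+2 r.+2 m + d * turan_cliques t.+1 r.+1 h +
    w * turan_edges r.+2 (m + d) <=
    turan_cliques t.+2 r.+2 (m + d) + w * turan_edges r.+2 m + d * (w * h).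
  elim: d {hE} => [|d IH]; first by rewrite addn0; lia.
  have := turan_cliques_tangent t r h (m + d - (m + d) %/ r.+2).
  by rewrite addnS turan_cliquesS turan_edgesS -/w; move: IH; lia.
have := turan_cliques_tangent t r h k; rewrite -/w.
by have := leq_mul (leqnn w) hE; move: H; lia.
Qed.

(** If f s exceeded f a, convexity would make f increase strictly from s on, so f b would exceed f a
    as well. *)
Lemma convex_leq_ends (f : nat -> nat) a b s :
  (forall i, 2 * f i.+1 <= f i + f i.+2) ->
  a <= s <= b -> f b <= f a -> f s <= f a.
Proof.
move=> cvx /andP[la lb] fab; rewrite leqNgt; apply/negP => fas.
have up d : f (a + d) <= f a \/ f a < f (a + d) < f (a + d).+1.
  elim: d => [|d IH]; first by left; rewrite addn0.
  by rewrite addnS; have := cvx (a + d); lia.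
have H d : f a < f (s + d) < f (s + d).+1.
  elim: d => [|d IH]; last by rewrite addnS; have := cvx (s + d); lia.
  by have := up (s - a); rewrite addn0 subnKC //; lia.
by have := H (b - s); rewrite subnKC //; lia.
Qed.

Lemma turan_edges_convex r n : 2 * turan_edges r n.+1 <= turan_edges r n.+2 + turan_edges r n.
Proof. by rewrite !turan_edgesS; have := leq_subdiv r (leqnSn n); lia. Qed.

(** Each increment j - floor(j/(r+1)) is at least r j/(r+1); summing these avoids the rounding terms
    of [turan_edges_closed]. *)
Lemma turan_edges_diff r m d :
  r.+1 * 2 * turan_edges r.+1 m + r * (d * (d + 2 * m)) <=
  r.+1 * 2 * turan_edges r.+1 (m + d) + r * d.
Proof.
elim: d => [|d IH]; first by rewrite addn0 muln0.
rewrite addnS turan_edgesS.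
have : r * (m + d) <= r.+1 * (m + d - (m + d) %/ r.+1).
  by rewrite mulnBr; have := leq_trunc_div (m + d) r.+1; lia.
by move: IH; move: (_ - _) (turan_edges _ _) (turan_edges _ _) => x y z; lia.
Qed.

(* The left-hand side is convex in s, with equality at s = 1, so it suffices to
   treat the largest s. For r <= 7 and n - k even equality can occur
   there, and the rounding term p (r - p) of [turan_edges_closed] matters: it is at
   most 2 (r - 1) exactly when r <= 7. *)
Lemma turan_edges_gap r n k s : 4 <= r -> 0 < s -> 2 * s + k <= n ->
  (if r <= 7 then 4 * (k + 1) + (r - 3) * (k + 2) <= (r - 3) * n
   else 4 * (k + 3) + (r - 4) * (k + 4) <= (r - 4) * n) ->
  turan_edges r (n - s) + s * (s + k - 1) <= turan_edges r n.-1 + k.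
Proof.
move=> r4 s0 sn cond.
pose f i := turan_edges r (n - i) + i * (i + k - 1).
have f1 : turan_edges r n.-1 + k = f 1 by rewrite /f subn1; lia.
have cvx i : 2 * f i.+1 <= f i + f i.+2.
  rewrite /f; have : 2 * turan_edges r (n - i.+1) <= turan_edges r (n - i) + turan_edges r (n - i.+2).
    have [ni|ni] := ltnP i.+1 n.
      have -> : n - i = (n - i.+2).+2 by lia.
      have -> : n - i.+1 = (n - i.+2).+1 by lia.
      exact: turan_edges_convex.
    have -> : n - i.+2 = 0 by lia.
    have [->|->] : n - i.+1 = 0 \/ n - i = 1 by lia.
      by rewrite {1}/turan_edges big_ord0.
    have -> : n - i.+1 = 0 by lia.
    by rewrite {1}/turan_edges big_ord0.
  by case: i => [|i]; nia.
rewrite f1 -/(f s); apply: (@convex_leq_ends f 1 ((n - k) %/ 2)) => //.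
  by rewrite s0 leq_divRL // mulnC; lia.
rewrite -{}f1 /f {f cvx}.
have [M0 nE] : 0 < (n - k) %/ 2 /\ (n = 2 * ((n - k) %/ 2) + k \/ n = 2 * ((n - k) %/ 2) + k + 1) by lia.
case: ((n - k) %/ 2) M0 nE => // s' _ {s s0 sn} nE.
have [q rE] : exists q, r = q.+4 by exists (r - 4); lia.
have -> : s'.+1 * (s'.+1 + k - 1) = k + s' * (s' + k + 1) by rewrite addSn subn1 /=; lia.
suff : turan_edges r (n - s'.+1) + s' * (s' + k + 1) <= turan_edges r n.-1.
  by lia.
case: nE cond => nE.
  have -> : n - s'.+1 = s' + k + 1 by lia.
  have -> : n.-1 = s' + k + 1 + s' by lia.
  case: ifP => r7.
    have := @turan_edges_closed r (s' + k + 1) ltac:(lia).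
    have := @turan_edges_closed r (s' + k + 1 + s') ltac:(lia).
    have : forall x, (x %% r) * (r - x %% r) <= 2 * r.-1.
      move=> x; have := ltn_pmod x (ltac:(lia) : 0 < r).
      move: (x %% r) => y yr.
      have /or4P qE : [|| q == 0, q == 1, q == 2 | q == 3] by lia.
      rewrite rE in yr *.
      by case: qE yr => /eqP->; do 7 (case: y => [|y] //).
    move=> /(_ (s' + k + 1 + s')).
    move: (_ %% r * _) (_ %% r * _) (turan_edges _ _) (turan_edges _ _) => x1 x2 e1 e2.
    rewrite {}nE {}rE {r4 r7}.
    have -> : q.+4 - 3 = q.+1 by lia.
    move=> h1 h2 h3 cond.
    (* At n = 2 s' + k + 2 the size condition reads 2 (k + 1) <= (r - 3) s'. *)
    have c' : s' * (2 * (k + 1)) <= s' * (q.+1 * s') by apply: leq_mul => //; lia.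
    (* The rounding term is below 2 r, hence costs less than one edge, and integrality removes
       it. *)
    have : 2 * q.+4 * (e1 + s' * (s' + k + 1)) < 2 * q.+4 * e2.+1.
      by move: h1 h2 h3; rewrite /= !expnS !expn0; lia.
    by rewrite ltn_pmul2l // ltnS.
  have := @turan_edges_diff q.+3 (s' + k + 1) s'; rewrite -rE {}nE.
  move: (turan_edges _ _) (turan_edges _ _) => e2 e1 h.
  have -> : r - 4 = q by lia.
  rewrite {}rE in h r7 * => cond.
  have c' : s' * (2 * k + q + 6) <= s' * (q * s') by apply: leq_mul => //; lia.
  have : q.+4 * 2 * (e1 + s' * (s' + k + 1)) <= q.+4 * 2 * e2 by lia.
  by rewrite leq_pmul2l.
have -> : n - s'.+1 = s' + k + 2 by lia.
have -> : n.-1 = s' + k + 2 + s' by lia.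
have := @turan_edges_diff q.+3 (s' + k + 2) s'; rewrite -rE.
move: (turan_edges _ _) (turan_edges _ _) => e2 e1 h cond.
have c' : s' * (2 * k) <= s' * (q.+1 * s' + q.+1).
  apply: leq_mul => //; move: cond; rewrite nE rE; case: ifP => _.
    have -> : q.+4 - 3 = q.+1 by lia.
    lia.
  have -> : q.+4 - 4 = q by lia.
  lia.
have : r * 2 * (e1 + s' * (s' + k + 1)) <= r * 2 * e2 by rewrite rE in h *; lia.
by rewrite leq_pmul2l // rE.
Qed.

(** * Numerical inequalities for r = 3 *)

(* m_i and s_i count the vertices of part i outside and inside the set of s'
   low-degree vertices. Uses 4 m (m + s) = (2 m + s)^2 - s^2. *)
Lemma three_part_edge_bound (m s : 'I_3 -> nat) e h N s' :
  \sum_i m i + s' = N -> \sum_i s i = s' ->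
  2 * e + \sum_i m i * (m i + s i) <= s' * h + (N - s') * N ->
  12 * e <= 6 * (s' * h) + (2 * N - s') ^ 2.
Proof.
rewrite !big_ord_recl !big_ord0 !addn0.
move: (m _) (m _) (m _) (s _) (s _) (s _) => m2 m1 m0 s2 s1 s0.
move=> <- <-.
have -> : m0 + (m1 + m2) + (s0 + (s1 + s2)) - (s0 + (s1 + s2)) = m0 + (m1 + m2) by lia.
have -> : 2 * (m0 + (m1 + m2) + (s0 + (s1 + s2))) - (s0 + (s1 + s2)) =
  (2 * m0 + s0) + ((2 * m1 + s1) + (2 * m2 + s2)) by lia.
have h01 := (nat_Cauchy (2 * m0 + s0) (2 * m1 + s1)).1.
have h02 := (nat_Cauchy (2 * m0 + s0) (2 * m2 + s2)).1.
have h12 := (nat_Cauchy (2 * m1 + s1) (2 * m2 + s2)).1.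
have p01 := leq0n (s0 * s1); have p02 := leq0n (s0 * s2); have p12 := leq0n (s1 * s2).
move: (_ * h) => z; move: h01 h02 h12; rewrite !expnS !expn0; lia.
Qed.

(* This is (2 n - s)^2 + 6 s (s + k - 1) < 4 ((n - 1)^2 - 1), the right-hand side
   being at most 12 e(T_3(n-1)). *)
Lemma quadratic_gap n k s : 6 * k + 20 <= n -> 3 <= s -> 2 * s + k <= n ->
  7 * s ^ 2 + 6 * k * s + 8 * n < 6 * s + 4 * n * s \/
  (n = 20 /\ k = 0 \/ n = 32 /\ k = 2) /\
  7 * s ^ 2 + 6 * k * s + 8 * n <= 6 * s + 4 * n * s + 1.
Proof.
move=> nk s3 sn; rewrite expnS expn1.
(* Large n is settled by substitution; otherwise n = 6 k + 20 + j with k + j < 10 leaves finitely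
   many pairs (k, j). *)
have [big|small] := leqP (5 * k + 30) n.
  have [a sE] : exists a, s = 3 + a by exists (s - 3); lia.
  have [b nE] : exists b, n = 5 * k + 30 + b by exists (n - (5 * k + 30)); lia.
  have : a * (2 * s + k) <= a * n by rewrite leq_mul.
  by have := leq0n (a * b); left; rewrite nE sE in sn *; lia.
have [a sE] : exists a, s = 3 + a by exists (s - 3); lia.
have [j nE] : exists j, n = 6 * k + 20 + j by exists (n - (6 * k + 20)); lia.
(* For fixed k and j, bounding one factor s by its largest value makes the goal linear in a. *)
have aS : a * s <= a * ((n - k) %/ 2) by apply: leq_mul => //; rewrite leq_divRL // mulnC; lia.
have kj : k + j < 10 by lia.
subst n s; clear nk s3 small.
do 10 (case: k sn aS kj => [|k] sn aS kj;
  [do 10 (case: j sn aS kj => [|j] sn aS kj;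
    [match type of aS with context [?x %/ 2] =>
       let y := eval vm_compute in (x %/ 2) in change (x %/ 2) with y in aS
     end; lia | try by [] ])
  | try by []]).
Qed.

Lemma turan_edges3 n : n ^ 2 <= 3 * turan_edges 3 n + 1.
Proof.
have := @turan_edges_closed 3 n isT; rewrite /=.
have : n %% 3 * (3 - n %% 3) <= 2 by have := ltn_pmod n (isT : 0 < 3); case: (n %% 3) => [|[|[|]]].
move: (_ * (3 - _)) => x; lia.
Qed.

Lemma turan3_edges_gap n k s e : 6 * k + 20 <= n -> 3 <= s -> 2 * s + k <= n ->
  12 * e <= 6 * (s * (s + k - 1)) + (2 * n - s) ^ 2 ->
  e < turan_edges 3 n.-1 \/ (n = 20 \/ n = 32 /\ k = 2) /\ e <= turan_edges 3 n.-1.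
Proof.
move=> nk s3 sn he; have := quadratic_gap nk s3 sn; have := turan_edges3 n.-1.
have [m nE] : exists m, n = m.+1 by exists n.-1; lia.
rewrite {}nE in nk sn he *; rewrite /= => hm.
have [d dE] : exists d, 2 * m.+1 - s = d by exists (2 * m.+1 - s).
have sE : 2 * m.+1 = s + d by lia.
rewrite dE in he.
have -> : 4 * m.+1 * s = 2 * (s + d) * s by rewrite -sE; lia.
have : 4 * m.+1 ^ 2 = (s + d) ^ 2 by rewrite -sE expnMn.
have sk : s * (s + k - 1) = s * s + s * k - s by rewrite mulnBr mulnDr muln1.
rewrite {}sk in he.
have : s <= s * s by rewrite leq_pmulr; lia.
move: (turan_edges _ _) hm he => E; rewrite !expnS !expn0 => *; lia.
Qed.

(** One edge fewer than T_3(m) outweighs the rounding error of the Fisher-Ryan bound with M = m. The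
    cases with possibly equal edge counts are computed directly. *)
Lemma turan3_triangles_gap m k e x : 0 < m ->
  e < turan_edges 3 m \/ (m = 19 \/ m = 31 /\ k = 2) /\ e <= turan_edges 3 m ->
  432 * m * x <= (9 * e + m ^ 2) ^ 2 ->
  x <= turan_cliques 3 3 m + turan_cliques 2 2 k.
Proof.
move=> m0 [elt|[mE e_le]] hx; last first.
- have E19 : 3 * turan_edges 3 19 = 360 by have := @turan_edges_closed 3 19 isT; rewrite (_ : 19 %% 3 = 1) //; lia.
  have E31 : 3 * turan_edges 3 31 = 960 by have := @turan_edges_closed 3 31 isT; rewrite (_ : 31 %% 3 = 1) //; lia.
  have T19 := turan_triangles1 6; have T31 := turan_triangles1 10.
  (* The bounds round down to 252 and 1101 triangles. T_3(19) has 252 triangles; T_3(31) has 1100,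
     and the edge of T_2(2) supplies one more. *)
  case: mE hx e_le => [->|[-> ->]] hx e_le; [rewrite T19|rewrite T31];
    rewrite leqNgt; apply/negP => xl.
    have : (9 * e + 19 ^ 2) ^ 2 <= (9 * 120 + 19 ^ 2) ^ 2 by rewrite leq_sqr; lia.
    lia.
  have C2 : turan_cliques 2 2 2 = 1.
    by rewrite turan_cliques2 /turan_edges !big_ord_recr big_ord0.
  rewrite C2 in xl; have : (9 * e + 31 ^ 2) ^ 2 <= (9 * 320 + 31 ^ 2) ^ 2 by rewrite leq_sqr; lia.
  lia.
apply: leq_trans (leq_addr _ _).
have := @turan_edges_closed 3 m isT.
have [q [p [p3 mE]]] : exists q p, p < 3 /\ m = 3 * q + p.
  by exists (m %/ 3), (m %% 3); rewrite ltn_pmod // [LHS](divn_eq m 3) mulnC.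
have pE : m %% 3 = p by rewrite mE mulnC modnMDl modn_small.
rewrite {}pE {}mE in m0 elt hx * => hE.
rewrite leqNgt; apply/negP => xl; move: hx; rewrite leqNgt => /negP; apply.
have h : (9 * e + (3 * q + p) ^ 2) ^ 2 <= (9 * (turan_edges 3 (3 * q + p)).-1 + (3 * q + p) ^ 2) ^ 2.
  by rewrite leq_sqr; lia.
apply: leq_ltn_trans h _.
apply: leq_trans (leq_mul (leqnn _) xl).
move: (turan_edges _ _) hE => E hE.
have q2 := leq0n (q * q); have q3 := leq0n (q * (q * q)).
have q4 := leq0n (q * (q * (q * q))).
case: p p3 m0 {elt xl} hE => [|[|[|]]] // _ m0 hE; rewrite ?addn0 ?addn1 ?addn2
  ?turan_triangles ?turan_triangles1 ?turan_triangles2.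
- case: q q2 q3 q4 hE m0 => // q q2 q3 q4 hE _.
  have -> : E.-1 = 3 * q ^ 2 + 6 * q + 2 by lia.
  rewrite !expnS !expn0; lia.
- case: q q2 q3 q4 hE {m0} => [|q] q2 q3 q4 hE; first by have -> : E = 0 by lia.
  have -> : E.-1 = 3 * q ^ 2 + 8 * q + 4 by lia.
  rewrite !expnS !expn0; lia.
- have -> : E = 3 * q ^ 2 + 4 * q + 1 by lia.
  rewrite addn1 /= !expnS !expn0; lia.
Qed.

(** * Graphs with a set of low-degree vertices *)

Section LowDegree.
Variables (V : finType) (G : sgraph V).
Implicit Types (S A B T : {set V}) (u v w : V).

(** T is deleted vertex by vertex; Zykov's theorem bounds the cliques lost in each neighborhood and
    those that remain. *)
Lemma low_degree_bound t r S T h : ncliques G r.+2 S = 0 -> T \subset S ->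
  {in T, forall v, #|S :&: nbhd G v| <= h} ->
  ncliques G t.+1 S <= turan_cliques t.+1 r.+1 (#|S| - #|T|) + #|T| * turan_cliques t r h.
Proof.
move: {2}#|T| (erefl #|T|) => n; elim: n S T => [|n IH] S T cT hS TS hT.
  by rewrite cT subn0 addn0; apply: zykov.
have [v vT] : exists v, v \in T by apply/set0Pn; rewrite -cards_eq0 cT.
have vS := subsetP TS v vT.
move: hS; rewrite (ncliques_del _ _ vS) => /eqP; rewrite addn_eq0 => /andP[/eqP h1 /eqP h2].
rewrite (ncliques_del _ _ vS).
have cT' := card_rem vT cT.
have c1 := leq_trans (zykov t h2) (turan_cliques_mono t r (hT v vT)).
have := IH (S :\ v) (T :\ v) cT' h1 (setSD _ TS).
have -> : #|S :\ v| - #|T :\ v| = #|S| - #|T|.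
  by have := cardsD1 v S; rewrite vS cT' cT; lia.
rewrite cT' cT mulSn => H; have := H _ => {H} H.
apply: leq_trans (leq_add (H _) c1) _; last by lia.
move=> w /setD1P[_ wT]; apply: leq_trans (hT w wT).
by apply/subset_leq_card/setSI/subsetDl.
Qed.

Lemma sum_by_color r (c : V -> nat) (f : nat -> nat) A : {in A, forall v, c v < r} ->
  \sum_(v in A) f (c v) = \sum_(i < r) #|[set v in A | c v == i]| * f i.
Proof.
move=> cr.
transitivity (\sum_(v in A) \sum_(i < r) (c v == i) * f i).
  apply: eq_bigr => v vA; rewrite (bigD1 (Ordinal (cr v vA))) //= eqxx mul1n.
  rewrite big1 ?addn0 // => i; rewrite -val_eqE /= eq_sym.
  by move=> /negPf->.
rewrite exchange_big; apply: eq_bigr => i _.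
rewrite -big_distrl /= -sum1_card; congr (_ * _).
rewrite [RHS](eq_bigl (fun v => (v \in A) && (c v == i))) => [|v]; last by rewrite inE.
by rewrite big_mkcondr; apply: eq_bigr => v _; case: eqP.
Qed.

(** In the degree sum, vertices of T count at most h each and the others at most #|S| minus their
    color class, by [degree_majorization]; [three_part_edge_bound] then eliminates the class
    sizes. *)
Lemma edges_low_degree S T h : ncliques G 4 S = 0 -> T \subset S ->
  {in T, forall v, #|S :&: nbhd G v| <= h} ->
  12 * ncliques G 2 S <= 6 * (#|T| * h) + (2 * #|S| - #|T|) ^ 2.
Proof.
move=> h4 TS hT; have [c c3 cdeg] := degree_majorization h4.
pose N i := #|[set u in S | c u == i]|.
pose m i := #|[set u in S :\: T | c u == i]|.
pose s i := #|[set u in T | c u == i]|.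
have NE i : N i = m i + s i.
  rewrite /N -(cardsID T) addnC; congr (_ + _); apply: eq_card => u; rewrite !inE.
    by rewrite -andbA.
  case uT : (u \in T); last by rewrite andbF.
  by rewrite (subsetP TS) // andbT.
have c3D : {in S :\: T, forall v, c v < 3} by move=> v /setDP[vS _]; apply: c3.
have c3T : {in T, forall v, c v < 3} by move=> v vT; apply/c3/(subsetP TS).
have sT : \sum_(i < 3) s i = #|T|.
  rewrite -sum1_card (sum_by_color (fun=> 1) c3T).
  by apply: eq_bigr => i _; rewrite muln1.
have cD : #|S :\: T| = #|S| - #|T| by rewrite cardsD (setIidPr TS).
have cTS := subset_leq_card TS.
have mT : \sum_(i < 3) m i + #|T| = #|S|.
  transitivity (#|S :\: T| + #|T|); last by rewrite cD subnK.
  rewrite -[#|S :\: T|]sum1_card (sum_by_color (fun=> 1) c3D).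
  by congr (_ + _); apply: eq_bigr => i _; rewrite muln1.
apply: (@three_part_edge_bound m s _ _ _ _ mT sT).
rewrite -handshake (bigID (mem T)) /= -addnA; apply: leq_add.
  rewrite -sum_nat_const (eq_bigl (mem T)) => [|v].
    by apply: leq_sum => v vT; apply: hT.
  by rewrite /= andbC; case vT: (v \in T) => //=; rewrite (subsetP TS).
rewrite (eq_bigl (mem (S :\: T))) => [|v]; last by rewrite /= !inE andbC.
have -> : \sum_(i < 3) m i * (m i + s i) = \sum_(v in S :\: T) N (c v).
  by rewrite (sum_by_color N c3D); apply: eq_bigr => i _; rewrite NE.
rewrite -cD -sum_nat_const -big_split /=; apply: leq_sum => v /setDP[vS _].
exact: cdeg.
Qed.

End LowDegree.

(** * The upper bound in both low-degree cases *)

Section MainBound.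
Variables (V : finType) (G : sgraph V).
Implicit Types (S A B T : {set V}) (u v w : V).

(** A consequence of [size_threshold] at l = k - 1, in natural numbers with denominators cleared. *)
Definition size_ok r k n :=
  if r == 3 then 6 * k + 20 <= n
  else if r <= 7 then 4 * (k + 1) + (r - 3) * (k + 2) <= (r - 3) * n
  else 4 * (k + 3) + (r - 4) * (k + 4) <= (r - 4) * n.

Lemma bound_low_vertex t r k v : ncliques G r.+2 setT = 0 -> deg G v <= k ->
  ncliques G t.+1 setT <= turan_cliques t.+1 r.+1 #|V|.-1 + turan_cliques t r k.
Proof.
move=> hG dv; have vT := in_setT v.
move: hG; rewrite !(ncliques_del _ _ vT) => /eqP; rewrite addn_eq0 => /andP[/eqP h1 /eqP h2].
apply: leq_add.
  apply: leq_trans (zykov _ h1) _; apply: turan_cliques_mono.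
  by have := cardsD1 v setT; rewrite vT cardsT => ->.
by apply: leq_trans (zykov _ h2) _; apply: turan_cliques_mono; rewrite setTI.
Qed.

(** For r >= 4 or s = 2 an edge comparison settles all clique sizes at once. For r = 3 and s >= 3,
    edges and triangles are treated separately and larger cliques do not exist. *)
Lemma bound_low_vertices t r k s T : 3 <= r -> ncliques G r.+1 setT = 0 ->
  size_ok r k #|V| -> 2 <= s -> #|T| = s -> 2 * s + k <= #|V| ->
  {in T, forall v, deg G v <= s + k - 1} ->
  ncliques G t.+2 setT <= turan_cliques t.+2 r #|V|.-1 + turan_cliques t.+1 r.-1 k.
Proof.
move=> r3 hG hn s2 cT sn hT; set n := #|V| in hn sn *.
have hT' : {in T, forall v, #|[set: V] :&: nbhd G v| <= s + k - 1}.
  by move=> v vT; rewrite setTI; apply: hT.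
have nE : n.-1 = n - s + (s - 1) by lia.
have s1 : (s - 1).+1 = s by lia.
have small : turan_edges r (n - s) + s * (s + k - 1) <= turan_edges r n.-1 + k ->
    ncliques G t.+2 setT <= turan_cliques t.+2 r n.-1 + turan_cliques t.+1 r.-1 k.
  case: r r3 hG {hn} => [|[|r]] // _ hG hE.
  have := low_degree_bound t.+1 hG (subsetT T) hT'; rewrite cT cardsT -/n.
  move=> h; apply: leq_trans h _.
  rewrite nE -{2}s1; apply: turan_cliques_gap.
  by rewrite s1 -nE.
have [rE|r4] := eqVneq r 3; last first.
  apply: small; apply: turan_edges_gap; rewrite ?(ltnW s2) //; first by lia.
  by move: hn; rewrite /size_ok (negPf r4).
subst r; rewrite /size_ok eqxx in hn.
have [s3|] := leqP 3 s; last first.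
  move=> s3; apply: small; have -> : s = 2 by lia.
  have -> : n.-1 = (n - 2).+1 by lia.
  by rewrite turan_edgesS; lia.
have e12 := edges_low_degree hG (subsetT T) hT'.
rewrite cT cardsT -/n in e12.
have he := turan3_edges_gap hn s3 sn e12.
case: t {small} => [|[|t]].
- rewrite turan_cliques2; apply: leq_trans (leq_addr _ _).
  by case: he => [/ltnW|[]].
- apply: turan3_triangles_gap (fisher_ryan n.-1 hG); first by lia.
  case: he => [h|[h1 h2]]; [by left | right; split=> //].
  by case: h1 => [->|[-> ->]]; [left | right].
- by rewrite (@ncliques_vanish _ G 4).
Qed.

End MainBound.

(** * Degree-sum closure, and clique counts of G* *)

Section Closure.
Variable V : finType.
Implicit Types (G H : sgraph V) (u v w : V).

Lemma adj_add_edge G u v x y : u != v ->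
  adj (add_edge G u v) x y = adj G x y || ([set x; y] == [set u; v]).
Proof.
move=> uv; rewrite in_graph_of !inE.
have [->|xy] := eqVneq x y; last by rewrite andbT orbC.
rewrite andbF adjxx /=; apply/esym/eqP => E.
by have := cards2 u v; rewrite -E cards2 eqxx uv.
Qed.

Lemma complete_adj G : (forall u v, u != v -> adj G u v) -> G = complete V.
Proof.
move=> hG; apply: val_inj; apply/setP => e; rewrite /= !inE.
apply/idP/idP => [eG|/cards2P[u [v [uv ->]]]].
  by have /forall_inP/(_ e eG) := edges_card2 G.
exact: hG.
Qed.

Lemma subset_deg G H v : (forall x y, adj G x y -> adj H x y) -> deg G v <= deg H v.
Proof.
by move=> GH; apply/subset_leq_card/subsetP => u; rewrite !inE; apply: GH.
Qed.

Lemma closure_exists (m : int) (P : sgraph V -> Prop) G : stable m P ->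
  exists H, [/\ forall x y, adj G x y -> adj H x y, P H -> P G &
    forall u v, u != v -> ~~ adj H u v -> ((deg H u + deg H v)%:Z < m)%R].
Proof.
move=> hP; pose nonedges G := [set p : V * V | ~~ adj G p.1 p.2].
have [k] := ubnP #|nonedges G|; elim: k G => // k IH G; rewrite ltnS => ck.
have [/existsP[u /existsP[v /and3P[uv nuv hd]]]|] :=
    boolP [exists u, exists v, [&& u != v, ~~ adj G u v & (m <= (deg G u + deg G v)%:Z)%R]].
  have [|H [GH PH cl]] := IH (add_edge G u v).
    apply: leq_trans ck; apply/proper_card/properP; split.
      by apply/subsetP => p; rewrite !inE adj_add_edge // negb_or => /andP[].
    by exists (u, v); rewrite !inE //= adj_add_edge // eqxx orbT.
  exists H; split=> //.
    by move=> x y xy; apply: GH; rewrite adj_add_edge // xy.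
  by move=> /PH /(hP G u v uv nuv); apply.
move=> hn; exists G; split=> // u v uv nuv; rewrite ltNge; apply/negP => hd.
move/existsP: hn; apply; exists u; apply/existsP; exists v.
by rewrite uv nuv.
Qed.

(* Chvatal's argument: in the closure, take a nonadjacent pair u, v of maximal
   degree sum with deg u <= deg v; all nonneighbors of v have degree at most
   deg u, and there are at least s of them if deg u = s + k - 1. *)
Lemma low_vertices (k : nat) (P : sgraph V -> Prop) G :
  stable (#|V|%:Z + k%:Z - 1)%R P -> P (complete V) -> ~ P G ->
  (exists v, deg G v <= k) \/
  exists s (T : {set V}), [/\ 2 <= s, #|T| = s, 2 * s + k <= #|V| &
    {in T, forall v, deg G v <= s + k - 1}].
Proof.
move=> hP Pc PG; have [H [GH PH cl]] := closure_exists G hP.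
pose Q (p : V * V) := (p.1 != p.2) && ~~ adj H p.1 p.2.
have [p0 Qp0] : exists p, Q p.
  apply/existsP; apply: contraT => /existsPn hQ; case: PG; apply: PH.
  rewrite (@complete_adj H) // => u v uv.
  by have := hQ (u, v); rewrite /Q /= uv /= negbK.
case: (@arg_maxnP _ p0 Q (fun p => deg H p.1 + deg H p.2) Qp0) => -[u0 v0] Q0 max0.
have [u [v [uv nuv duv pmax]]] : exists u v, [/\ u != v, ~~ adj H u v, deg H u <= deg H v &
    forall w, w != v -> ~~ adj H w v -> deg H w <= deg H u].
  have /andP[/= uv nuv] := Q0.
  have [h|h] := leqP (deg H u0) (deg H v0).
    exists u0, v0; split=> // w wv nwv.
    by have := max0 (w, v0); rewrite /Q /= wv nwv leq_add2r; apply.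
  exists v0, u0; split; rewrite 1?eq_sym 1?adjC //; first exact: ltnW.
  move=> w wv nwv; have := max0 (w, u0); rewrite /Q /= wv nwv addnC leq_add2l.
  by apply.
have sum : deg H u + deg H v + 2 <= #|V| + k.
  by move: (cl u v uv nuv); move: (deg H u) (deg H v) #|V| => a b c; lia.
have [small|big] := leqP (deg H u) k.
  by left; exists u; apply: leq_trans small; apply: subset_deg.
right; set h := deg H u in sum big *.
pose W := ~: (v |: nbhd H v).
have cW : h + 1 - k <= #|W|.
  rewrite /W cardsCs setCK cardsU1 inE adjxx /= -/(deg H v).
  by move: sum duv; rewrite -/h; move: #|V| => N; lia.
(* This s solves h = s + k - 1; h > k gives s >= 2, and 2 h <= deg u + deg v <= n + k - 2 gives 2 s
   + k <= n. *)
exists (h + 1 - k), [set x in take (h + 1 - k) (enum W)]; split.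
- by lia.
- rewrite cardsE (card_uniqP _) ?take_uniq ?enum_uniq // size_takel //.
  by rewrite -cardE.
- by move: sum duv; rewrite -/h; lia.
move=> w; rewrite inE => /mem_take; rewrite mem_enum !inE negb_or => /andP[wv nw].
apply: leq_trans (subset_deg w GH) _; have := pmax w wv.
by rewrite adjC => /(_ nw); rewrite -/h; lia.
Qed.

(** Giving x the color of the part that its neighborhood avoids yields a proper r-coloring, which is
    injective on cliques. *)
Lemma Gstar_clique_free (l : int) r G : is_Gstar l r G -> clique_free r.+1 G.
Proof.
case=> x [c [i [[hadj _] _ dis _ _]]] A clA cA.
pose c2 v := if v == x then i else c v.
have xadj v : adj G x v -> c v != i.
  move=> xv; apply/negP => /eqP cv; have := disjointFr dis (x := v).
  rewrite !inE xv cv eqxx andbT => /(_ isT)/negbFE/eqP vx.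
  by rewrite vx adjxx in xv.
have inj : {in A &, injective c2}.
  move=> u v uA vA; rewrite /c2; apply: contra_eq => uv.
  have uvG : adj G u v.
    by move: clA => /forall_inP/(_ u uA)/forall_inP/(_ v vA)/implyP; apply.
  have [ux|ux] := eqVneq u x; have [vx|vx] := eqVneq v x.
  - by rewrite ux vx eqxx in uv.
  - by rewrite eq_sym xadj // -ux.
  - by rewrite xadj // -vx adjC.
  - by rewrite -hadj // !inE.
have := max_card (mem (c2 @: A)).
by rewrite card_in_imset // cA card_ord ltnn.
Qed.

(** The cliques avoiding x lie in T_r(n-1); those through x come from T_{r-1}(k) in its
    neighborhood. *)
Lemma Gstar_lower (k : nat) r t G : is_Gstar (k%:Z - 1)%R r G ->
  turan_cliques t.+1 r #|V|.-1 + turan_cliques t r.-1 k <= num_cliques t.+1 G.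
Proof.
case=> x [c [i [[adj1 bal1] _ _ cN [c' [adj2 bal2]]]]].
rewrite num_cliquesE (ncliques_del _ _ (in_setT x)) setTD setTI.
have -> : #|V|.-1 = #|[set~ x]| by rewrite cardsC1.
have -> : k = #|nbhd G x| by lia.
apply: leq_add.
  by apply: (turan_lower _ (c := c) (C := setT)); rewrite ?cardsT ?card_ord //; move=> *; rewrite ?inE.
by apply: (turan_lower _ (c := c') (C := setT)); rewrite ?cardsT ?card_ord //; move=> *; rewrite ?inE.
Qed.

End Closure.

(** * The size condition and the conclusion *)

Lemma size_threshold_ok (k r n : nat) : 3 <= r ->
  (size_threshold (k%:Z - 1) r <= n%:R)%R -> size_ok r k n.
Proof.
move=> r3; rewrite /size_threshold /size_ok rmorphB /= -pmulrn.
have [rE|rn3] := eqVneq r 3.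
  subst r => h; rewrite -(ler_nat rat) natrD natrM; lra.
have [j rE] : exists j, r = 4 + j by exists (r - 4); lia.
case: leqP => r7.
  rewrite ge_max => /andP[+ _].
  have -> : r - 3 = j.+1 by lia.
  have -> : (r%:R - 3 = j.+1%:R :> rat)%R by rewrite rE natrD -natr1; lra.
  move=> h; rewrite -(ler_nat rat) !(natrD, natrM).
  have J : (0 < j.+1%:R :> rat)%R by rewrite ltr0n.
  move: h; set q := (_ / _)%R => h.
  have qE : (q * j.+1%:R = 4 * (k%:R + 1))%R by rewrite /q divfK ?lt0r_neq0 //; lra.
  rewrite -qE mulrC -mulrDr ler_pM2l //; lra.
have -> : r - 4 = j by lia.
have -> : (r%:R - 4 = j%:R :> rat)%R by rewrite rE natrD; lra.
move=> h; rewrite -(ler_nat rat) !(natrD, natrM).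
have J : (0 < j%:R :> rat)%R by rewrite ltr0n; lia.
move: h; set q := (_ / _)%R => h.
have qE : (q * j%:R = 4 * (k%:R + 3))%R by rewrite /q divfK ?lt0r_neq0 //; lra.
rewrite -qE mulrC -mulrDr ler_pM2l //; lra.
Qed.

Theorem theorem2p20
  (l : int) (hl : (-1 <= l)%R)
  (P : forall m : nat, sgraph 'I_m -> Prop)
  (hP : forall m : nat, stable (m%:Z + l)%R (P m))
  (nP : int)
  (hnP : forall m : nat, (nP <= m%:Z)%R -> P m (complete 'I_m))
  (r n : nat) (hr : 3 <= r) (hn : (nP <= n%:Z)%R)
  (hsize : (size_threshold l r <= n%:R)%R)
  (Gstar : sgraph 'I_n) (hGstar : is_Gstar l r Gstar)
  (t : nat) (ht : 2 <= t) :
  (forall G : sgraph 'I_n, clique_free r.+1 G -> ~ P n G ->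
     num_cliques t G <= num_cliques t Gstar) /\
  (~ P n Gstar ->
     exists G : sgraph 'I_n,
       [/\ clique_free r.+1 G, ~ P n G
         & num_cliques t G = num_cliques t Gstar]).
Proof.
split=> [G cfG PG|nPG]; last first.
  (* Tightness is witnessed by G* itself. *)
  by exists Gstar; split=> //; apply: Gstar_clique_free hGstar.
have [k lE] : exists k : nat, l = (k%:Z - 1)%R by exists `|(l + 1)%R|; lia.
rewrite {}lE {l hl} in hP hsize hGstar.
case: t ht => [|[|t]] // _.
apply: leq_trans (Gstar_lower _ hGstar).
have hG := clique_free_ncliques cfG; rewrite num_cliquesE.
have hst : stable (#|'I_n|%:Z + k%:Z - 1)%R (P n) by rewrite card_ord -addrA; apply: hP.
have hs := size_threshold_ok hr hsize; rewrite -{}[n in size_ok _ _ n]card_ord in hs.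
case: (low_vertices hst (hnP n hn) PG) => [[v dv]|[s [T [s2 cT sn hT]]]].
  case: r hr hG {hsize hGstar cfG hs} => [|[|r]] // _ hG.
  exact: bound_low_vertex hG dv.
exact: bound_low_vertices hr hG hs s2 cT sn hT.
Qed.
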